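(* Let $n$ be a positive integer. (i) If $n$ is odd, then $$A_n = \frac{8}{\pi}\cdot \frac{n!}{(n!!)^2} \cdot \sum_{j=0}^{(n-1)/2} \frac{(2j-1)!!}{(2j)!!}\, \frac{1}{2j+1},$$ and if $n$ is even, then $$A_n = \frac{16}{\pi}\cdot \frac{n!}{(n!!)^2} \cdot \sum_{j=0}^{(n-2)/2} \frac{(2j)!!}{(2j+1)!!}\, \frac{1}{2j+2}.$$ (ii) If $n$ is odd, then the number $$n! \sum_{j=0}^{(n-1)/2} \frac{(2j-1)!!}{(2j)!!}\, \frac{1}{2j+1}$$ equals the $n$th term $a_n$ of the sequence $(a_m)_{m\ge 0}$ with exponential generating function $\dfrac{\arcsin x}{1-x}=\sum_{m\ge 0} a_m \dfrac{x^m}{m!}$. (iii) If $n$ is even, then the number $$n! \sum_{j=0}^{(n-2)/2} \frac{(2j)!!}{(2j+1)!!}\, \frac{1}{2j+2}$$ equals the $n$th term $b_n$ of the sequence $(b_m)_{m\ge 0}$ with exponential generating function $\dfrac{\arcsin^2 x}{2(1-x)}=\sum_{m\ge 0} b_m \dfrac{x^m}{m!}$.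
   Context: For a positive integer $n$, $A_n$ denotes the limiting area between the graphs of $\cos^n x$ and $\cos^n kx$ over $[0,\pi]$: $$A_n = \lim_{k \to \infty} \int_0^\pi \big| \cos^n x - \cos^n (kx) \big| \, dx,$$ where $k$ runs through the positive integers (both parities). Here $\cos^n \theta = (\cos\theta)^n$ and $\arcsin^2 x = (\arcsin x)^2$. Double factorials: $(2j)!! = (2j)(2j-2)\cdots 4\cdot 2$ and $(2j+1)!! = (2j+1)(2j-1)\cdots 3\cdot 1$, with the convention $0!! = (-1)!! = 1$. The exponential generating function identities are understood as power series expansions at $x=0$. *)

(* Defs.v *)
(* Stdlib reals, with Coquelicot for integrals, limits and power series. *)
From Stdlib Require Import Reals Factorial.
From Coquelicot Require Import Coquelicot.
Open Scope R_scope.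

(* Double factorial.  In an expression such as (2j-1)!! the subtraction on nat
   is truncated: for j = 0 it gives [dfact 0 = 1], which is the convention
   (-1)!! = 1. *)
Fixpoint dfact (n : nat) : nat :=
  match n with
  | O => 1
  | S p => match p with O => 1 | S m => n * dfact m end
  end%nat.

(* The integrand is continuous, so [RInt] is its genuine Riemann integral. *)
Definition area (n k : nat) : R :=
  RInt (fun x => Rabs (cos x ^ n - cos (INR k * x) ^ n)) 0 PI.

(* A is the limit of the areas; the index k = 0 does not affect it. *)
Definition is_limiting_area (n : nat) (A : R) : Prop :=
  is_lim_seq (fun k => area n k) (Finite A).

(* [sum_f_R0 f N] is f 0 + ... + f N, both ends included. *)
Definition odd_sum (n : nat) : R :=
  sum_f_R0 (fun j => INR (dfact (2 * j - 1)) / INR (dfact (2 * j))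
                     * (1 / INR (2 * j + 1)))
           ((n - 1) / 2).

Definition even_sum (n : nat) : R :=
  sum_f_R0 (fun j => INR (dfact (2 * j)) / INR (dfact (2 * j + 1))
                     * (1 / INR (2 * j + 2)))
           ((n - 2) / 2).

(* f x = sum_m a_m x^m / m! in a neighbourhood of 0; this determines a. *)
Definition is_egf (a : nat -> R) (f : R -> R) : Prop :=
  exists r : R, 0 < r /\
    forall x : R, Rabs x < r -> is_pseries (fun m => a m / INR (fact m)) x (f x).

(* Main.v *)
Require Import Defs.
From Stdlib Require Import Reals Factorial Lia Lra.
From Coquelicot Require Import Coquelicot.
Open Scope R_scope.

(** As [k] grows, [cos (k x) ^ n] runs through many periods while [x] hardly
    moves, so in the limit the phase of the fast factor becomes a variable [y]
    independent of [x] and uniform on [[0, PI]]: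
      [A_n = 1/PI * double integral of |cos x ^ n - cos y ^ n| over [0, PI]^2]
    ([limiting_area_total_distance]).  The proof compares both sides on cells
    of length [PI / k]; since [cos ^ n] is Lipschitz, each cell contributes an
    error of order [1 / k ^ 2], and there are [k] cells.

    For a decreasing [f] on [[0, b]] the absolute value in the double integral
    opens up, and an integration by parts turns it into
    [2 * int_0^b (b - 2 x) f x] ([total_distance_decreasing]).  For [n] odd this
    applies to [cos ^ n] with [b = PI]; for [n] even, the symmetry about
    [PI / 2] first reduces the square [[0, PI]^2] to four copies of
    [[0, PI / 2]^2], where [cos ^ n] decreases.

    With [q m = (m-1)!! / m!!], the usual reduction for powers of the cosine
    expresses [int (b - 2 x) cos x ^ (n+2)] as [(n+1) / (n+2)] times the
    integral for [n], plus a boundary term proportional to [1 / (n+2) ^ 2].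
    Dividing by [q (n+2)] and using [(m+1) q m q (m+1) = 1], each step adds
    [q (n+1) / (n+2)] to a sum: this is the sum of the theorem
    ([weighted_cos_integral_step]).

    The same numbers [q m / (m+1)] are the Taylor coefficients of
    [arcsin x + (arcsin x) ^ 2 / 2], at [x ^ (m+1)]: even [m] gives [arcsin],
    odd [m] gives the square.  Indeed the derivative
    [v = (alpha + beta arcsin x) / sqrt (1 - x ^ 2)] solves
    [(1 - x ^ 2) v' = beta + x v], which on coefficients is the recurrence
    [(m+2) d (m+2) = (m+1) d m] satisfied by [q].  Dividing by [1 - x] replaces
    the coefficients by their partial sums ([is_egf_arcsin_combination]), and
    coefficients of a power series are unique ([is_egf_unique]). *)

(** * Ratios of double factorials *)

Definition dfact_ratio (m : nat) : R := INR (dfact (m - 1)) / INR (dfact m).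

Lemma dfact_pos (m : nat) : 0 < INR (dfact m).
Proof.
  apply lt_0_INR.
  enough (H : (0 < dfact m /\ 0 < dfact (S m))%nat) by apply H.
  induction m as [|m [IH1 IH2]]; [simpl; lia|].
  split; [exact IH2|].
  change (dfact (S (S m))) with (S (S m) * dfact m)%nat; lia.
Qed.

Lemma dfact_SS (m : nat) : INR (dfact (S (S m))) = INR (S (S m)) * INR (dfact m).
Proof. now rewrite <- mult_INR. Qed.

Lemma dfact_S (m : nat) : INR (dfact (S m)) = INR (S m) * INR (dfact (m - 1)).
Proof.
  destruct m as [|m]; [simpl; lra|].
  replace (S m - 1)%nat with m by lia. apply dfact_SS.
Qed.

Lemma dfact_ratio_SS (m : nat) :
  dfact_ratio (S (S m)) = INR (S m) / INR (S (S m)) * dfact_ratio m.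
Proof.
  unfold dfact_ratio.
  replace (S (S m) - 1)%nat with (S m) by lia.
  rewrite dfact_S, dfact_SS.
  pose proof (dfact_pos m). pose proof (lt_0_INR (S (S m)) ltac:(lia)).
  field; lra.
Qed.

Lemma fact_dfact (m : nat) : INR (fact (S m)) = INR (dfact (S m)) * INR (dfact m).
Proof.
  induction m as [|m IH]; [simpl; lra|].
  change (fact (S (S m))) with (S (S m) * fact (S m))%nat.
  rewrite mult_INR, IH, dfact_SS; ring.
Qed.

(** This is where the prefactor of the area formulas comes from: the quotient
    of consecutive double factorials, since [m! = m!! (m-1)!!]. *)
Lemma fact_div_dfact_sqr (m : nat) :
  INR (fact m) / INR (dfact m) ^ 2 = dfact_ratio m.
Proof.
  unfold dfact_ratio. destruct m as [|m]; [simpl; field|].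
  replace (S m - 1)%nat with m by lia.
  rewrite fact_dfact. pose proof (dfact_pos (S m)). field; lra.
Qed.

Lemma dfact_ratio_bounds (m : nat) : 0 < dfact_ratio m <= 1.
Proof.
  enough (H : 0 < dfact_ratio m <= 1 /\ 0 < dfact_ratio (S m) <= 1) by apply H.
  induction m as [|m [IH1 IH2]].
  { unfold dfact_ratio; simpl; lra. }
  split; [exact IH2|]. rewrite dfact_ratio_SS.
  assert (H : 0 < INR (S m) / INR (S (S m)) <= 1).
  { pose proof (lt_0_INR (S m) ltac:(lia)). rewrite (S_INR (S m)).
    split; [apply Rdiv_lt_0_compat; lra|].
    apply (Rmult_le_reg_r (INR (S m) + 1)); [lra|].
    field_simplify; lra. }
  nra.
Qed.

(** The product telescopes to [(m-1)!! / (m+1)!!].  This trades the quotient by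
    [dfact_ratio (S m)] in the reduction of the integrals for a factor
    [dfact_ratio m], the one in the Taylor coefficients. *)
Lemma dfact_ratio_mul_S (m : nat) :
  INR (S m) * (dfact_ratio m * dfact_ratio (S m)) = 1.
Proof.
  unfold dfact_ratio. replace (S m - 1)%nat with m by lia.
  rewrite dfact_S.
  pose proof (dfact_pos m). pose proof (dfact_pos (m - 1)).
  pose proof (lt_0_INR (S m) ltac:(lia)). field; lra.
Qed.

(** The coefficient of [x ^ (m+1)] in [arcsin x + (arcsin x) ^ 2 / 2]: the terms
    of both sums of the theorem, interleaved. *)
Definition arcsin_coef (m : nat) : R := dfact_ratio m / INR (S m).

Lemma odd_sum_arcsin_coef (m : nat) :
  odd_sum (2 * m + 1) = sum_f_R0 (fun j => arcsin_coef (2 * j)) m.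
Proof.
  unfold odd_sum. rewrite Nat.add_sub, Nat.mul_comm, Nat.div_mul by lia.
  apply sum_eq. intros j _. unfold arcsin_coef, dfact_ratio.
  replace (2 * j + 1)%nat with (S (2 * j)) by lia. unfold Rdiv. ring.
Qed.

Lemma even_sum_arcsin_coef (m : nat) :
  even_sum (2 * m + 2) = sum_f_R0 (fun j => arcsin_coef (2 * j + 1)) m.
Proof.
  unfold even_sum. rewrite Nat.add_sub, Nat.mul_comm, Nat.div_mul by lia.
  apply sum_eq. intros j _. unfold arcsin_coef, dfact_ratio.
  replace (2 * j + 1 - 1)%nat with (2 * j)%nat by lia.
  replace (2 * j + 2)%nat with (S (2 * j + 1)) by lia. unfold Rdiv. ring.
Qed.

(** * Power series of the arcsine and of its square *)

Lemma CV_radius_bounded_ge_1 (a : nat -> R) :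
  (forall m, Rabs (a m) <= 1) -> Rbar_le 1 (CV_radius a).
Proof.
  intros Ha. apply (proj1 (CV_radius_bounded a)).
  exists 1. intros m. rewrite pow1, Rmult_1_r. apply Ha.
Qed.

Lemma in_CV_radius (a : nat -> R) (x : R) :
  Rbar_le 1 (CV_radius a) -> Rabs x < 1 -> Rbar_lt (Rabs x) (CV_radius a).
Proof. intros Ha Hx. now apply Rbar_lt_le_trans with 1. Qed.

Lemma is_derive_asin (x : R) : Rabs x < 1 -> is_derive asin x (/ sqrt (1 - x ^ 2)).
Proof.
  intros Hx. apply Rabs_def2 in Hx.
  apply is_derive_Reals. assert (Hx' : -1 < x < 1) by lra.
  apply (derive_pt_eq_1 _ _ _ (derivable_pt_asin x Hx')).
  rewrite derive_pt_asin, Rsqr_pow2. unfold Rdiv. apply Rmult_1_l.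
Qed.

Lemma zero_derive_const (f : R -> R) (x : R) :
  (forall t, Rabs t < 1 -> is_derive f t 0) -> Rabs x < 1 -> f x = f 0.
Proof.
  intros Hf Hx.
  assert (H : Rabs (f x - f 0) <= 0 * Rabs (x - 0)).
  { apply (bounded_variation f (fun _ => 0)). intros t Ht.
    rewrite !Rminus_0_r in Ht. split; [apply Hf; lra|rewrite Rabs_R0; lra]. }
  rewrite Rmult_0_l in H. pose proof (Rabs_pos (f x - f 0)).
  apply Rminus_diag_uniq, Rabs_eq_0. lra.
Qed.

Lemma is_pseries_ones (x : R) : Rabs x < 1 -> is_pseries (fun _ => 1) x (/ (1 - x)).
Proof.
  intros Hx. unfold is_pseries.
  apply (is_series_ext (fun n => x ^ n)); [|now apply is_series_geom].
  intros n. change (x ^ n = pow_n x n * 1). rewrite (pow_n_pow x n). ring.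
Qed.

(** All solutions of [(m+2) d (m+2) = (m+1) d m]: the parity classes decouple,
    and [al], [be] are the two initial values. *)
Definition weighted_ratio (al be : R) (m : nat) : R :=
  (if Nat.even m then al else be) * dfact_ratio m.

Section ArcsinSeries.

Variables al be : R.
Hypothesis al01 : 0 <= al <= 1.
Hypothesis be01 : 0 <= be <= 1.

Let d := weighted_ratio al be.

Lemma weighted_ratio_SS (m : nat) :
  INR (S (S m)) * d (S (S m)) = INR (S m) * d m.
Proof.
  unfold d, weighted_ratio. rewrite dfact_ratio_SS. simpl Nat.even.
  pose proof (lt_0_INR (S (S m)) ltac:(lia)). field; lra.
Qed.

Lemma weighted_ratio_bound (m : nat) : Rabs (d m) <= 1.
Proof.
  pose proof (dfact_ratio_bounds m).
  unfold d, weighted_ratio. rewrite Rabs_pos_eq; destruct (Nat.even m); nra.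
Qed.

Lemma CV_radius_weighted_ratio : Rbar_le 1 (CV_radius d).
Proof. apply CV_radius_bounded_ge_1, weighted_ratio_bound. Qed.

(** On coefficients the recurrence reads
    [d' (m+1) = (m+1) d m = m d m + d m], where [d'] is the differentiated
    sequence and [m d m] is the coefficient of [x v']; hence
    [v' = be + x (x v' + v)]. *)
Lemma PSeries_weighted_ratio_ode (x : R) : Rabs x < 1 ->
  (1 - x ^ 2) * PSeries (PS_derive d) x = be + x * PSeries d x.
Proof.
  intros Hx.
  assert (Hd : Rbar_lt (Rabs x) (CV_radius d))
    by now apply in_CV_radius; [apply CV_radius_weighted_ratio|].
  assert (Hd' : ex_pseries (PS_derive d) x)
    by (apply CV_radius_inside; now rewrite CV_radius_derive).
  assert (E : PSeries (PS_derive d) x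
              = be + x * (x * PSeries (PS_derive d) x + PSeries d x)).
  { rewrite PSeries_decr_1 at 1 by exact Hd'.
    rewrite <- (PSeries_incr_1 (PS_derive d)), <- PSeries_plus.
    - f_equal.
      + unfold PS_derive, d, weighted_ratio, dfact_ratio. simpl. field.
      + f_equal. apply PSeries_ext. intros m.
        unfold PS_decr_1, PS_plus, PS_derive. rewrite weighted_ratio_SS.
        destruct m as [|m]; unfold plus, zero; simpl PS_incr_1; cbn -[INR d].
        * simpl INR. lra.
        * rewrite (S_INR (S m)). unfold plus; simpl; ring.
    - now apply ex_pseries_incr_1.
    - now apply CV_radius_inside. }
  lra.
Qed.

(** The integrating factor of the differential equation is [sqrt (1 - x ^ 2)]:
    [v sqrt (1 - x ^ 2)] has derivative [be / sqrt (1 - x ^ 2)]. *)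
Lemma PSeries_weighted_ratio (x : R) : Rabs x < 1 ->
  PSeries d x = (al + be * asin x) / sqrt (1 - x ^ 2).
Proof.
  intros Hx.
  assert (Hpos : forall t, Rabs t < 1 -> 0 < 1 - t ^ 2).
  { intros t Ht. apply Rabs_def2 in Ht. nra. }
  assert (H : PSeries d x * sqrt (1 - x ^ 2) - be * asin x
              = PSeries d 0 * sqrt (1 - 0 ^ 2) - be * asin 0).
  { apply (zero_derive_const (fun t => PSeries d t * sqrt (1 - t ^ 2) - be * asin t));
      [|exact Hx].
    intros t Ht. specialize (Hpos t Ht).
    assert (Hs : 0 < sqrt (1 - t ^ 2)) by now apply sqrt_lt_R0.
    assert (Hd := is_derive_PSeries d t
      (in_CV_radius d t CV_radius_weighted_ratio Ht)).
    assert (Hode := PSeries_weighted_ratio_ode t Ht).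
    assert (Hsq : sqrt (1 - t ^ 2) * sqrt (1 - t ^ 2) = 1 - t ^ 2)
      by (apply sqrt_sqrt; lra).
    assert (Has := is_derive_asin t Ht).
    set (s := sqrt (1 - t ^ 2)) in *.
    assert (Hsd : is_derive (fun t => sqrt (1 - t ^ 2)) t (- t / s)).
    { unfold s. auto_derive; [nra|].
      replace (1 + - (t * (t * 1))) with (1 - t ^ 2) by ring. fold s. field. lra. }
    replace 0 with (PSeries (PS_derive d) t * s + PSeries d t * (- t / s) - be * / s).
    - apply (is_derive_minus (fun t => PSeries d t * sqrt (1 - t ^ 2)) (fun t => be * asin t)).
      + apply (is_derive_mult (fun t => PSeries d t) (fun t => sqrt (1 - t ^ 2))); auto.
        intros; apply Rmult_comm.
      + now apply is_derive_scal.
    - apply (Rmult_eq_reg_r s); [|lra]. field_simplify; [|lra].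
      replace (s ^ 2) with (1 - t ^ 2) by (rewrite <- Hsq; ring). lra. }
  rewrite PSeries_0, asin_0 in H.
  replace (1 - 0 ^ 2) with 1 in H by ring. rewrite sqrt_1 in H.
  assert (Hd0 : d 0%nat = al).
  { unfold d, weighted_ratio, dfact_ratio; simpl; field. }
  assert (Hs : 0 < sqrt (1 - x ^ 2)) by now apply sqrt_lt_R0, Hpos.
  apply (Rmult_eq_reg_r (sqrt (1 - x ^ 2))); [|lra].
  field_simplify; [|lra]. rewrite Hd0 in H. lra.
Qed.

Lemma CV_radius_Int_weighted_ratio : Rbar_le 1 (CV_radius (PS_Int d)).
Proof. rewrite CV_radius_Int. apply CV_radius_weighted_ratio. Qed.

(** Both sides vanish at [0] and have derivative
    [(al + be arcsin x) / sqrt (1 - x ^ 2)]. *)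
Lemma is_pseries_arcsin_combination (x : R) : Rabs x < 1 ->
  is_pseries (PS_Int d) x (al * asin x + be * (asin x ^ 2 / 2)).
Proof.
  intros Hx.
  assert (H : PSeries (PS_Int d) x - (al * asin x + be * (asin x ^ 2 / 2))
       = PSeries (PS_Int d) 0 - (al * asin 0 + be * (asin 0 ^ 2 / 2))).
  { apply (zero_derive_const
      (fun t => PSeries (PS_Int d) t - (al * asin t + be * (asin t ^ 2 / 2))));
      [|exact Hx].
    intros t Ht.
    assert (Hd := is_derive_PSeries (PS_Int d) t
      (in_CV_radius _ t CV_radius_Int_weighted_ratio Ht)).
    rewrite (PSeries_ext _ d), PSeries_weighted_ratio in Hd;
      [| exact Ht |].
    2:{ intros m. unfold PS_derive, PS_Int. field.
        now apply not_0_INR. }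
    assert (Has := is_derive_asin t Ht).
    set (s := sqrt (1 - t ^ 2)) in *.
    replace 0 with ((al + be * asin t) / s - (al * / s + be * (asin t * / s)))
      by (unfold Rdiv; ring).
    apply (is_derive_minus (fun t => PSeries (PS_Int d) t)
             (fun t => al * asin t + be * (asin t ^ 2 / 2))); [exact Hd|].
    assert (Ea : Derive (fun u => asin u) t = / s) by exact (is_derive_unique _ _ _ Has).
    auto_derive; [repeat split; now exists (/ s)|].
    rewrite Ea. field. unfold s.
    apply Rgt_not_eq, sqrt_lt_R0. apply Rabs_def2 in Ht. nra. }
  rewrite PSeries_0, asin_0 in H. simpl in H.
  replace (al * asin x + be * (asin x ^ 2 / 2)) with (PSeries (PS_Int d) x) by (simpl; lra).
  apply PSeries_correct, CV_radius_inside, in_CV_radius; [|exact Hx].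
  apply CV_radius_Int_weighted_ratio.
Qed.

(** Multiplication by the geometric series sums the coefficients. *)
Lemma is_egf_arcsin_combination :
  is_egf (fun m => INR (fact m) * sum_f_R0 (PS_Int d) m)
         (fun x => (al * asin x + be * (asin x ^ 2 / 2)) / (1 - x)).
Proof.
  exists 1. split; [lra|]. intros x Hx.
  assert (E : forall m, PS_mult (PS_Int d) (fun _ => 1) m
                        = INR (fact m) * sum_f_R0 (PS_Int d) m / INR (fact m)).
  { intros m. unfold PS_mult.
    rewrite (sum_eq _ (PS_Int d)) by (intros; ring).
    field. apply INR_fact_neq_0. }
  apply (is_pseries_ext _ _ _ _ E).
  apply is_pseries_mult.
  - now apply is_pseries_arcsin_combination.
  - now apply is_pseries_ones.
  - apply in_CV_radius; [apply CV_radius_Int_weighted_ratio|exact Hx].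
  - apply in_CV_radius; [|exact Hx].
    apply CV_radius_bounded_ge_1. intros _. rewrite Rabs_R1. lra.
Qed.

End ArcsinSeries.

Lemma PS_Int_weighted_ratio_odd (al be : R) (j : nat) :
  PS_Int (weighted_ratio al be) (S (2 * j)) = al * arcsin_coef (2 * j).
Proof.
  unfold PS_Int, weighted_ratio, arcsin_coef. rewrite Nat.even_mul. simpl orb. cbv iota.
  unfold Rdiv. ring.
Qed.

Lemma PS_Int_weighted_ratio_even (al be : R) (j : nat) :
  PS_Int (weighted_ratio al be) (S (2 * j + 1)) = be * arcsin_coef (2 * j + 1).
Proof.
  assert (E : Nat.even (2 * j + 1) = false) by now rewrite Nat.even_add, Nat.even_mul.
  unfold PS_Int, weighted_ratio, arcsin_coef. rewrite E.
  unfold Rdiv. ring.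
Qed.

Lemma odd_sum_PS_Int (m : nat) :
  sum_f_R0 (PS_Int (weighted_ratio 1 0)) (2 * m + 1) = odd_sum (2 * m + 1).
Proof.
  rewrite odd_sum_arcsin_coef. induction m as [|m IH].
  - simpl. unfold weighted_ratio, arcsin_coef, dfact_ratio. simpl. field.
  - replace (2 * S m + 1)%nat with (S (S (2 * m + 1))) by lia. rewrite !tech5, IH.
    rewrite PS_Int_weighted_ratio_even.
    replace (S (S (2 * m + 1))) with (S (2 * S m)) by lia.
    rewrite PS_Int_weighted_ratio_odd. ring.
Qed.

Lemma even_sum_PS_Int (m : nat) :
  sum_f_R0 (PS_Int (weighted_ratio 0 1)) (2 * m + 2) = even_sum (2 * m + 2).
Proof.
  rewrite even_sum_arcsin_coef. induction m as [|m IH].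
  - simpl. unfold weighted_ratio, arcsin_coef, dfact_ratio. simpl. field.
  - replace (2 * S m + 2)%nat with (S (S (2 * m + 2))) by lia. rewrite !tech5, IH.
    replace (S (2 * m + 2)) with (S (2 * (m + 1))) at 1 by lia.
    rewrite PS_Int_weighted_ratio_odd.
    replace (S (2 * m + 2)) with (2 * S m + 1)%nat by lia.
    rewrite PS_Int_weighted_ratio_even. ring.
Qed.

(** * Uniqueness of exponential generating functions *)

Lemma is_egf_CV_radius (a : nat -> R) (f : R -> R) :
  is_egf a f -> Rbar_lt 0 (CV_radius (fun m => a m / INR (fact m))).
Proof.
  intros [r [Hr Ha]].
  destruct (Rbar_lt_le_dec 0 (CV_radius (fun m => a m / INR (fact m)))) as [H|H]; [exact H|].
  (* Outside the disk of convergence the terms would not tend to 0, but the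
     series converges at r / 2. *)
  exfalso. apply (CV_disk_outside (fun m => a m / INR (fact m)) (r / 2)).
  - apply Rbar_le_lt_trans with 0; [exact H|].
    simpl. apply Rabs_pos_lt; lra.
  - assert (Hx : Rabs (r / 2) < r) by (rewrite Rabs_pos_eq; lra).
    apply (ex_series_lim_0 (fun n => a n / INR (fact n) * (r / 2) ^ n)).
    exists (f (r / 2)). specialize (Ha (r / 2) Hx). unfold is_pseries in Ha.
    eapply is_series_ext; [|exact Ha]. intros n.
    change (pow_n (r / 2) n * (a n / INR (fact n)) = a n / INR (fact n) * (r / 2) ^ n).
    rewrite (pow_n_pow (r / 2) n). ring.
Qed.

Lemma is_egf_unique (a b : nat -> R) (f : R -> R) (m : nat) :
  is_egf a f -> is_egf b f -> a m = b m.
Proof.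
  intros Ha Hb.
  assert (H : a m / INR (fact m) = b m / INR (fact m)).
  { apply (PSeries_ext_recip (fun m => a m / INR (fact m)) (fun m => b m / INR (fact m))).
    - now apply is_egf_CV_radius with f.
    - now apply is_egf_CV_radius with f.
    - destruct Ha as [r [Hr Ha]], Hb as [s [Hs Hb]].
      exists (mkposreal (Rmin r s) (Rmin_pos r s Hr Hs)). intros x Hx.
      change (Rabs (x - 0) < Rmin r s) in Hx. rewrite Rminus_0_r in Hx.
      pose proof (Rmin_l r s). pose proof (Rmin_r r s).
      rewrite (is_pseries_unique _ _ _ (Ha x ltac:(lra))).
      now rewrite (is_pseries_unique _ _ _ (Hb x ltac:(lra))). }
  pose proof (INR_fact_neq_0 m).
  apply (Rmult_eq_reg_r (/ INR (fact m))); [exact H|]. now apply Rinv_neq_0_compat.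
Qed.

Lemma is_egf_ext (a : nat -> R) (f g : R -> R) :
  (forall x, f x = g x) -> is_egf a f -> is_egf a g.
Proof.
  intros E [r [Hr Ha]]. exists r. split; [exact Hr|].
  intros x Hx. rewrite <- E. now apply Ha.
Qed.

(** * Integrals of continuous real functions *)

(** Derivatives and integrals produce equations over the carrier of a normed
    module, which [ring] and [field] recognize only once retyped over [R]. *)
Ltac real_eq := match goal with |- @eq _ ?a ?b => change (@eq R a b) end.

Lemma RInt_plus_R (f g : R -> R) (a b : R) :
  (forall x, continuous f x) -> (forall x, continuous g x) ->
  RInt (fun x => f x + g x) a b = RInt f a b + RInt g a b :> R.
Proof. intros Hf Hg. apply (RInt_plus (V := R_CompleteNormedModule)); now apply ex_RInt_continuous. Qed.

Lemma RInt_minus_R (f g : R -> R) (a b : R) :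
  (forall x, continuous f x) -> (forall x, continuous g x) ->
  RInt (fun x => f x - g x) a b = RInt f a b - RInt g a b :> R.
Proof. intros Hf Hg. apply (RInt_minus (V := R_CompleteNormedModule)); now apply ex_RInt_continuous. Qed.

Lemma RInt_scal_R (f : R -> R) (c a b : R) :
  (forall x, continuous f x) ->
  RInt (fun x => c * f x) a b = c * RInt f a b :> R.
Proof. intros Hf. apply (RInt_scal (V := R_CompleteNormedModule)); now apply ex_RInt_continuous. Qed.

Lemma RInt_const_R (c a b : R) : RInt (fun _ => c) a b = (b - a) * c :> R.
Proof. apply (RInt_const (V := R_CompleteNormedModule)). Qed.

Lemma RInt_Chasles_R (f : R -> R) (a b c : R) :
  (forall x, continuous f x) -> RInt f a b + RInt f b c = RInt f a c :> R.
Proof. intros Hf. apply (RInt_Chasles (V := R_CompleteNormedModule)); now apply ex_RInt_continuous. Qed.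

Lemma RInt_derivative (F f : R -> R) (a b : R) :
  (forall x, is_derive F x (f x)) -> (forall x, continuous f x) ->
  RInt f a b = F b - F a :> R.
Proof.
  intros HF Hf. apply is_RInt_unique.
  apply (is_RInt_derive (V := R_CompleteNormedModule)); auto.
Qed.

Lemma is_derive_primitive (f : R -> R) (a x : R) :
  (forall x, continuous f x) -> is_derive (fun t => RInt f a t) x (f x).
Proof.
  intros Hf. apply (is_derive_RInt f _ a); [|apply Hf].
  apply filter_forall. intros t. apply (RInt_correct (V := R_CompleteNormedModule)).
  now apply ex_RInt_continuous.
Qed.

Lemma continuous_is_derive (f : R -> R) (x l : R) : is_derive f x l -> continuous f x.
Proof. intros H. apply (ex_derive_continuous (V := R_NormedModule)). now exists l. Qed.

Lemma continuous_mult_R (f g : R -> R) (x : R) :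
  continuous f x -> continuous g x -> continuous (fun t => f t * g t) x.
Proof. intros. now apply (continuous_mult (K := R_AbsRing)). Qed.

Lemma continuous_minus_R (f g : R -> R) (x : R) :
  continuous f x -> continuous g x -> continuous (fun t => f t - g t) x.
Proof. intros. now apply (continuous_minus (V := R_NormedModule)). Qed.

Lemma RInt_reflect (f : R -> R) (s a b : R) :
  (forall x, continuous f x) ->
  RInt (fun x => f (s - x)) a b = RInt f (s - b) (s - a) :> R.
Proof.
  intros Hf.
  rewrite (RInt_derivative (fun x => - RInt f 0 (s - x)) (fun x => f (s - x))).
  - rewrite <- (RInt_Chasles_R f 0 (s - b) (s - a) Hf). ring.
  - intros x. replace (f (s - x)) with (- (-1 * f (s - x))) by ring.
    apply (is_derive_opp (fun x => RInt f 0 (s - x))).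
    apply (is_derive_comp (fun t => RInt f 0 t) (fun x => s - x)).
    + now apply is_derive_primitive.
    + auto_derive; [exact I|real_eq; ring].
  - intros x. apply (continuous_comp (fun x => s - x) f); [|apply Hf].
    apply continuous_is_derive with (-1). auto_derive; [exact I|real_eq; ring].
Qed.

Lemma RInt_dilate (f : R -> R) (k a b : R) : k <> 0 ->
  (forall x, continuous f x) ->
  RInt (fun x => f (k * x)) a b = / k * RInt f (k * a) (k * b) :> R.
Proof.
  intros Hk Hf.
  rewrite (RInt_derivative (fun x => / k * RInt f 0 (k * x)) (fun x => f (k * x))).
  - rewrite <- (RInt_Chasles_R f 0 (k * a) (k * b) Hf). ring.
  - intros x. replace (f (k * x)) with (/ k * (k * f (k * x))) by (field; exact Hk).
    apply (is_derive_scal (fun x => RInt f 0 (k * x))).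
    apply (is_derive_comp (fun t => RInt f 0 t) (fun x => k * x)).
    + now apply is_derive_primitive.
    + auto_derive; [exact I|real_eq; ring].
  - intros x. apply (continuous_comp (fun x => k * x) f); [|apply Hf].
    apply continuous_is_derive with k. auto_derive; [exact I|real_eq; ring].
Qed.

(** * The limit of the areas as a double integral *)

Definition lipschitz (L : R) (f : R -> R) : Prop :=
  forall x y, Rabs (f x - f y) <= L * Rabs (x - y).

Lemma lipschitz_continuous (L : R) (f : R -> R) (x : R) :
  lipschitz L f -> continuous f x.
Proof.
  intros Hf.
  assert (HL : 0 <= L).
  { specialize (Hf 1 0). rewrite Rminus_0_r, Rabs_R1 in Hf.
    pose proof (Rabs_pos (f 1 - f 0)). lra. }
  apply continuity_pt_filterlim. intros eps Heps.
  exists (eps / (L + 1)). split; [apply Rdiv_lt_0_compat; lra|].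
  intros y [_ Hy]. simpl in *. unfold R_dist in *.
  apply Rle_lt_trans with (1 := Hf y x).
  apply Rle_lt_trans with (L * (eps / (L + 1))).
  - apply Rmult_le_compat_l; lra.
  - apply (Rmult_lt_reg_r (L + 1)); [lra|]. field_simplify; nra.
Qed.

Definition total_distance (b : R) (f : R -> R) : R :=
  RInt (fun x => RInt (fun y => Rabs (f x - f y)) 0 b) 0 b.

Lemma continuous_dist (c : R) (f : R -> R) (x : R) :
  continuous f x -> continuous (fun y => Rabs (c - f y)) x.
Proof.
  intros Hf. apply (continuous_Rabs_comp (fun y => c - f y)).
  apply continuous_minus_R; [apply continuous_const|exact Hf].
Qed.

Lemma lipschitz_section_integral (L b : R) (f p : R -> R) :
  0 <= b -> lipschitz L f -> (forall x, continuous p x) ->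
  lipschitz (b * L) (fun x => RInt (fun y => Rabs (f x - p y)) 0 b).
Proof.
  intros Hb Hf Hp x y.
  rewrite <- RInt_minus_R by (intros; apply continuous_dist, Hp).
  replace (b * L * Rabs (x - y)) with ((b - 0) * (L * Rabs (x - y))) by ring.
  apply abs_RInt_le_const; [lra| |].
  - apply (ex_RInt_continuous (V := R_CompleteNormedModule)). intros z _.
    apply continuous_minus_R; apply continuous_dist, Hp.
  - intros t _. apply Rle_trans with (Rabs (f x - f y)); [|apply Hf].
    replace (f x - f y) with ((f x - p t) - (f y - p t)) by ring.
    apply Rabs_triang_inv2.
Qed.

(** A Lipschitz function [f] is compared with the rapidly oscillating
    [p (k x)], where [p] has the same distribution on each
    [[j PI, (j+1) PI]].  This covers [cos ^ n] of both parities: for [n] odd,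
    [PI] is not a period, only a period up to reflection of the cell. *)
Section Equidistribution.

Variables (L : R) (f p : R -> R).
Hypothesis Hf : lipschitz L f.
Hypothesis Hp : forall x, continuous p x.
Hypothesis Hcell : forall (c : R) (j : nat),
  RInt (fun u => Rabs (c - p u)) (INR j * PI) (INR (S j) * PI)
  = RInt (fun u => Rabs (c - p u)) 0 PI.

Let h (x : R) : R := RInt (fun y => Rabs (f x - p y)) 0 PI.

Let lipschitz_h : lipschitz (PI * L) h.
Proof. apply lipschitz_section_integral; [pose proof PI_RGT_0; lra|exact Hf|exact Hp]. Qed.

Lemma continuous_rapid (k : R) (x : R) : continuous (fun x => p (k * x)) x.
Proof.
  apply (continuous_comp (fun x => k * x) p); [|apply Hp].
  apply continuous_is_derive with k. auto_derive; [exact I|real_eq; ring].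
Qed.

Lemma continuous_integrand (k x : R) :
  continuous (fun x => Rabs (f x - p (k * x))) x.
Proof.
  apply (continuous_Rabs_comp (fun x => f x - p (k * x))).
  apply continuous_minus_R; [now apply lipschitz_continuous with L|apply continuous_rapid].
Qed.

Let e (k x : R) : R := Rabs (f x - p (k * x)) - / PI * h x.

Lemma continuous_section_integral (x : R) : continuous (fun x => / PI * h x) x.
Proof.
  apply continuous_mult_R; [apply continuous_const|].
  apply lipschitz_continuous with (PI * L), lipschitz_h.
Qed.

Lemma continuous_defect (k x : R) : continuous (e k) x.
Proof.
  apply continuous_minus_R; [apply continuous_integrand|apply continuous_section_integral].
Qed.

(** Freezing the slow variable at the left end [a] of the cell costs at most
    [L * PI / k] pointwise, in the integrand and in its average [h / PI] alike;
    with the slow variable frozen the defect integrates to zero, because [k x]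
    then sweeps exactly one cell of [p]. *)
Lemma cell_defect (k : R) (j : nat) : 0 < k ->
  Rabs (RInt (e k) (INR j * (PI / k)) (INR (S j) * (PI / k)))
  <= PI / k * (2 * L * (PI / k)).
Proof.
  intros Hk. pose proof PI_RGT_0.
  assert (Hw : 0 < PI / k) by now apply Rdiv_lt_0_compat.
  set (a := INR j * (PI / k)). set (b := INR (S j) * (PI / k)).
  assert (Hab : b - a = PI / k) by (unfold a, b; rewrite S_INR; ring).
  set (ea := fun x => Rabs (f a - p (k * x)) - / PI * h a).
  assert (Ca : forall x, continuous (fun x => Rabs (f a - p (k * x))) x).
  { intros x. apply (continuous_dist (f a) (fun x => p (k * x))), continuous_rapid. }
  assert (Cea : forall x, continuous ea x).
  { intros x. apply continuous_minus_R; [apply Ca|apply continuous_const]. }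
  assert (E0 : RInt ea a b = 0 :> R).
  { unfold ea. rewrite RInt_minus_R; [|exact Ca|intros; apply continuous_const].
    rewrite RInt_const_R, Hab.
    rewrite (RInt_dilate (fun u => Rabs (f a - p u)));
      [|lra|intros; apply continuous_dist, Hp].
    replace (k * a) with (INR j * PI) by (unfold a; field; lra).
    replace (k * b) with (INR (S j) * PI) by (unfold b; field; lra).
    rewrite Hcell. fold (h a). field. lra. }
  replace (RInt (e k) a b) with (RInt (fun x => e k x - ea x) a b).
  2:{ rewrite RInt_minus_R; [lra|apply continuous_defect|exact Cea]. }
  rewrite <- Hab.
  apply abs_RInt_le_const; [lra| |].
  - apply (ex_RInt_continuous (V := R_CompleteNormedModule)). intros z _.
    apply continuous_minus_R; [apply continuous_defect|apply Cea].
  - intros x Hx. unfold e, ea.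
    assert (H1 : Rabs (f x - f a) <= L * Rabs (x - a)) by apply Hf.
    assert (H2 : Rabs (h a - h x) <= PI * L * Rabs (a - x))
      by apply lipschitz_h.
    rewrite (Rabs_minus_sym a x) in H2.
    assert (H3 : Rabs (x - a) <= b - a) by (rewrite Rabs_pos_eq; lra).
    assert (H4 : Rabs (Rabs (f x - p (k * x)) - Rabs (f a - p (k * x)))
                 <= Rabs (f x - f a)).
    { replace (f x - f a) with ((f x - p (k * x)) - (f a - p (k * x))) by ring.
      apply Rabs_triang_inv2. }
    assert (HL : 0 <= L).
    { specialize (Hf 1 0). rewrite Rminus_0_r, Rabs_R1 in Hf.
      pose proof (Rabs_pos (f 1 - f 0)). lra. }
    replace (Rabs (f x - p (k * x)) - / PI * h x
             - (Rabs (f a - p (k * x)) - / PI * h a))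
      with ((Rabs (f x - p (k * x)) - Rabs (f a - p (k * x))) + / PI * (h a - h x))
      by ring.
    apply Rle_trans with (1 := Rabs_triang _ _).
    rewrite Rabs_mult, (Rabs_pos_eq (/ PI)) by (left; now apply Rinv_0_lt_compat).
    assert (H5 : / PI * Rabs (h a - h x) <= L * Rabs (x - a)).
    { apply (Rmult_le_reg_l PI); [lra|]. rewrite <- Rmult_assoc, Rinv_r by lra. lra. }
    assert (L * Rabs (x - a) <= L * (b - a)) by now apply Rmult_le_compat_l.
    lra.
Qed.

Lemma total_defect (k : R) (m : nat) : 0 < k ->
  Rabs (RInt (e k) 0 (INR m * (PI / k))) <= INR m * (PI / k * (2 * L * (PI / k))).
Proof.
  intros Hk. induction m as [|m IH].
  - simpl INR. rewrite !Rmult_0_l, RInt_point. unfold zero; simpl. rewrite Rabs_R0. lra.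
  - rewrite <- (RInt_Chasles_R (e k) 0 (INR m * (PI / k))) by apply continuous_defect.
    apply Rle_trans with (1 := Rabs_triang _ _).
    pose proof (cell_defect k m Hk). rewrite (S_INR m) in *. lra.
Qed.

Lemma rapid_oscillation_limit :
  is_lim_seq (fun k => RInt (fun x => Rabs (f x - p (INR k * x))) 0 PI)
    (Finite (/ PI * RInt (fun x => RInt (fun y => Rabs (f x - p y)) 0 PI) 0 PI)).
Proof.
  apply is_lim_seq_incr_1.
  fold h. set (A := / PI * RInt h 0 PI).
  set (C := 2 * L * PI ^ 2).
  assert (Hlim : is_lim_seq (fun k => C * / INR (S k)) (Finite 0)).
  { replace (Finite 0) with (Rbar_mult C (Rbar_inv p_infty)) by (simpl; f_equal; ring).
    apply is_lim_seq_scal_l. apply is_lim_seq_inv; [|discriminate].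
    apply (is_lim_seq_incr_1 INR), is_lim_seq_INR. }
  assert (Hdiff : forall k,
    Rabs (RInt (fun x => Rabs (f x - p (INR (S k) * x))) 0 PI - A) <= C * / INR (S k)).
  { intros k. assert (Hk : 0 < INR (S k)) by (apply lt_0_INR; lia).
    pose proof (total_defect (INR (S k)) (S k) Hk) as H.
    replace (INR (S k) * (PI / INR (S k))) with PI in H by (field; lra).
    unfold e in H. rewrite RInt_minus_R in H;
      [|apply continuous_integrand|apply continuous_section_integral].
    rewrite RInt_scal_R in H
      by (intros; apply lipschitz_continuous with (PI * L), lipschitz_h).
    fold A in H. apply Rle_trans with (1 := H). right. unfold C. field. lra. }
  apply (is_lim_seq_le_le (fun k => A - C * / INR (S k)) _ (fun k => A + C * / INR (S k))).
  - intros k. specialize (Hdiff k). apply Rabs_le_between in Hdiff. lra.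
  - replace (Finite A) with (Finite (A - 0)) by (f_equal; ring).
    apply is_lim_seq_minus'; [apply is_lim_seq_const|exact Hlim].
  - replace (Finite A) with (Finite (A + 0)) by (f_equal; ring).
    apply is_lim_seq_plus'; [apply is_lim_seq_const|exact Hlim].
Qed.

End Equidistribution.

Lemma continuous_cos_pow (n : nat) (x : R) : continuous (fun x => cos x ^ n) x.
Proof. apply (ex_derive_continuous (V := R_NormedModule)). auto_derive. exact I. Qed.

Lemma lipschitz_cos_pow (n : nat) : lipschitz (INR n) (fun x => cos x ^ n).
Proof.
  intros x y.
  apply (bounded_variation (fun x => cos x ^ n)
           (fun t => INR n * (- sin t) * cos t ^ pred n)).
  intros t _. split.
  - auto_derive; [exact I|real_eq; ring].
  - rewrite !Rabs_mult, (Rabs_pos_eq (INR n)), Rabs_Ropp, <- RPow_abs by apply pos_INR.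
    pose proof (pos_INR n). pose proof (Rabs_pos (sin t)).
    assert (Rabs (sin t) <= 1) by (apply Rabs_le, SIN_bound).
    assert (Hc : 0 <= Rabs (cos t) <= 1)
      by (split; [apply Rabs_pos|apply Rabs_le, COS_bound]).
    assert (0 <= Rabs (cos t) ^ pred n <= 1)
      by (split; [now apply pow_le|rewrite <- (pow1 (pred n)); now apply pow_incr]).
    rewrite Rmult_assoc. rewrite <- (Rmult_1_r (INR n)) at 2.
    apply Rmult_le_compat_l; [lra|]. nra.
Qed.

(** The reflection [u |-> 2 (j+1) PI - u] exchanges neighbouring cells and
    preserves the cosine, whatever the parity of [n]. *)
Lemma cos_pow_cell (n : nat) (c : R) (j : nat) :
  RInt (fun u => Rabs (c - cos u ^ n)) (INR j * PI) (INR (S j) * PI)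
  = RInt (fun u => Rabs (c - cos u ^ n)) 0 PI :> R.
Proof.
  induction j as [|j IH].
  - simpl INR. now rewrite Rmult_0_l, Rmult_1_l.
  - rewrite <- IH.
    rewrite (RInt_ext (fun u => Rabs (c - cos u ^ n))
               (fun u => Rabs (c - cos (2 * INR (S j) * PI - u) ^ n)) (INR (S j) * PI)).
    + rewrite (RInt_reflect (fun u => Rabs (c - cos u ^ n)))
        by (intros; apply continuous_dist, continuous_cos_pow).
      f_equal; rewrite !S_INR; ring.
    + intros u _. replace (2 * INR (S j) * PI - u) with (- u + 2 * INR (S j) * PI) by ring.
      now rewrite cos_period, cos_neg.
Qed.

Lemma limiting_area_total_distance (n : nat) :
  is_limiting_area n (/ PI * total_distance PI (fun x => cos x ^ n)).
Proof.
  apply (rapid_oscillation_limit (INR n) (fun x => cos x ^ n) (fun x => cos x ^ n)).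
  - apply lipschitz_cos_pow.
  - apply continuous_cos_pow.
  - apply cos_pow_cell.
Qed.

(** * Evaluation of the double integral *)

(** With [S x] the integral of [f] over [[0, x]], the inner integral splits at
    [y = x] into [(b - 2 x) f x + (2 S x - S b)].  The two summands have the
    same integral over [[0, b]]: their difference is the derivative of
    [(b - 2 x) S x + x S b], which vanishes at both ends. *)
Lemma total_distance_decreasing (b : R) (f : R -> R) :
  0 <= b -> (forall x, continuous f x) ->
  (forall x y, 0 <= x -> x <= y -> y <= b -> f y <= f x) ->
  total_distance b f = 2 * RInt (fun x => (b - 2 * x) * f x) 0 b.
Proof.
  intros Hb Hf Hdec. unfold total_distance.
  set (S := fun t => RInt f 0 t).
  assert (HS : forall x, is_derive S x (f x)) by (intros; now apply is_derive_primitive).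
  assert (CS : forall x, continuous S x) by (intros x; apply continuous_is_derive with (f x), HS).
  assert (Cw : forall x, continuous (fun x => (b - 2 * x) * f x) x).
  { intros x. apply continuous_mult_R; [|apply Hf].
    apply continuous_is_derive with (-2). auto_derive; [exact I|real_eq; ring]. }
  assert (CT : forall x, continuous (fun x => 2 * S x - S b) x).
  { intros x. apply continuous_minus_R; [|apply continuous_const].
    apply continuous_mult_R; [apply continuous_const|apply CS]. }
  rewrite (RInt_ext _ (fun x => (b - 2 * x) * f x + (2 * S x - S b))).
  2:{ intros x. rewrite Rmin_left, Rmax_right by exact Hb. intros Hx.
      rewrite <- (RInt_Chasles_R _ 0 x b) by (intros; now apply continuous_dist).
      rewrite (RInt_ext (fun y => Rabs (f x - f y)) (fun y => f y - f x) 0 x).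
      2:{ intros y. rewrite Rmin_left, Rmax_right by lra. intros Hy.
          rewrite Rabs_minus_sym. apply Rabs_pos_eq.
          specialize (Hdec y x ltac:(lra) ltac:(lra) ltac:(lra)). lra. }
      rewrite (RInt_ext (fun y => Rabs (f x - f y)) (fun y => f x - f y) x b).
      2:{ intros y. rewrite Rmin_left, Rmax_right by lra. intros Hy.
          apply Rabs_pos_eq.
          specialize (Hdec x y ltac:(lra) ltac:(lra) ltac:(lra)). lra. }
      rewrite !RInt_minus_R by (first [exact Hf | intros; apply continuous_const]).
      rewrite !RInt_const_R.
      assert (E : RInt f 0 x + RInt f x b = RInt f 0 b) by now apply RInt_Chasles_R.
      unfold S. lra. }
  rewrite RInt_plus_R by (exact Cw || exact CT).
  enough (E : RInt (fun x => (b - 2 * x) * f x) 0 b - RInt (fun x => 2 * S x - S b) 0 b = 0)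
    by lra.
  rewrite <- RInt_minus_R by (exact Cw || exact CT).
  rewrite (RInt_derivative (fun x => (b - 2 * x) * S x + x * S b)).
  - unfold S at 3. rewrite RInt_point. unfold zero; simpl. ring.
  - intros x. assert (E : Derive (fun t => S t) x = f x)
      by (apply is_derive_unique, HS).
    auto_derive; [repeat split; exists (f x); apply HS|]. rewrite E. ring.
  - intros x. apply continuous_minus_R; [apply Cw|apply CT].
Qed.

Lemma RInt_fold (g : R -> R) (b : R) :
  (forall x, continuous g x) -> (forall x, g (2 * b - x) = g x) ->
  RInt g 0 (2 * b) = 2 * RInt g 0 b :> R.
Proof.
  intros Hg Hsym. rewrite <- (RInt_Chasles_R g 0 b) by exact Hg.
  assert (E : RInt g b (2 * b) = RInt g 0 b); [|lra].
  rewrite <- (RInt_ext (fun x => g (2 * b - x))) by (intros; apply Hsym).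
  rewrite RInt_reflect by exact Hg. f_equal; ring.
Qed.

(** Each of the two integrations is halved by the symmetry about [b]. *)
Lemma total_distance_fold (L b : R) (f : R -> R) :
  lipschitz L f -> 0 < b -> (forall x, f (2 * b - x) = f x) ->
  total_distance (2 * b) f = 4 * total_distance b f.
Proof.
  intros Hf Hb Hsym. unfold total_distance.
  assert (Cf : forall x, continuous f x)
    by (intros; now apply lipschitz_continuous with L).
  assert (Csec : forall x, continuous (fun x => RInt (fun y => Rabs (f x - f y)) 0 b) x).
  { intros x. apply lipschitz_continuous with (b * L).
    apply lipschitz_section_integral; [lra|exact Hf|exact Cf]. }
  rewrite (RInt_ext _ (fun x => 2 * RInt (fun y => Rabs (f x - f y)) 0 b)).
  2:{ intros x _. apply RInt_fold.
      - intros; now apply continuous_dist.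
      - intros y. now rewrite Hsym. }
  rewrite RInt_scal_R, RInt_fold; [ring|exact Csec| |exact Csec].
  intros x. now rewrite Hsym.
Qed.

Lemma cos_pow_decreasing_odd (n : nat) (x y : R) : Nat.Odd n ->
  0 <= x -> x <= y -> y <= PI -> cos y ^ n <= cos x ^ n.
Proof.
  intros [m ->] Hx Hxy Hy.
  assert (H : cos y <= cos x) by (apply cos_decr_1; lra).
  replace (2 * m + 1)%nat with (S (2 * m)) by lia.
  generalize dependent (cos x). generalize (cos y). clear.
  intros a c H. rewrite <- !tech_pow_Rmult, !pow_mult.
  assert (Ha : 0 <= a ^ 2) by nra. assert (Hc : 0 <= c ^ 2) by nra.
  pose proof (pow_le _ m Ha). pose proof (pow_le _ m Hc).
  (* Odd powers increase on each side of 0, and change sign at 0. *)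
  destruct (Rle_lt_dec 0 a) as [Ha0|Ha0]; [|destruct (Rle_lt_dec 0 c) as [Hc0|Hc0]].
  - assert ((a ^ 2) ^ m <= (c ^ 2) ^ m) by (apply pow_incr; nra). nra.
  - nra.
  - assert ((c ^ 2) ^ m <= (a ^ 2) ^ m) by (apply pow_incr; nra). nra.
Qed.

Lemma cos_pow_decreasing_quarter (n : nat) (x y : R) :
  0 <= x -> x <= y -> y <= PI / 2 -> cos y ^ n <= cos x ^ n.
Proof.
  intros Hx Hxy Hy. pose proof PI_RGT_0.
  apply pow_incr. split; [apply cos_ge_0; lra|apply cos_decr_1; lra].
Qed.

Definition weighted_cos_integral (b : R) (n : nat) : R :=
  RInt (fun x => (b - 2 * x) * cos x ^ n) 0 b.

(** Integrating the derivative of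
    [(b - 2 x) cos x ^ (n+1) sin x - 2 / (n+2) cos x ^ (n+2)]; the hypothesis
    removes the first boundary term, both for [b = PI] and for [b = PI / 2]. *)
Lemma weighted_cos_integral_SS (b : R) (n : nat) :
  cos b ^ S n * sin b = 0 ->
  INR (S (S n)) * weighted_cos_integral b (S (S n))
  = INR (S n) * weighted_cos_integral b n + 2 / INR (S (S n)) * (1 - cos b ^ S (S n)).
Proof.
  intros Hb. pose proof (lt_0_INR (S (S n)) ltac:(lia)) as Hn.
  assert (C : forall m x, continuous (fun x => (b - 2 * x) * cos x ^ m) x).
  { intros m x. apply (ex_derive_continuous (V := R_NormedModule)). auto_derive. exact I. }
  unfold weighted_cos_integral.
  enough (E : INR (S (S n)) * RInt (fun x => (b - 2 * x) * cos x ^ S (S n)) 0 b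
    - INR (S n) * RInt (fun x => (b - 2 * x) * cos x ^ n) 0 b
    = 2 / INR (S (S n)) * (1 - cos b ^ S (S n))) by lra.
  rewrite <- !RInt_scal_R by apply C.
  rewrite <- RInt_minus_R.
  2,3: intros x; apply continuous_mult_R; [apply continuous_const|apply C].
  rewrite (RInt_derivative (fun x => (b - 2 * x) * (cos x ^ S n * sin x)
                                     - 2 / INR (S (S n)) * cos x ^ S (S n))).
  - rewrite Hb, cos_0, sin_0, !pow1. ring.
  - intros x. auto_derive; [exact I|].
    change (match n with 0%nat => 1 | S _ => INR n + 1 end) with (INR (S n)).
    rewrite (S_INR (S n)) in *. simpl pow. simpl pred.
    assert (E : sin x * sin x = 1 - cos x * cos x).
    { pose proof (sin2_cos2 x) as H. unfold Rsqr in H. lra. }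
    replace (1 * - sin x * (INR (S n) * cos x ^ n) * sin x)
      with (- (INR (S n) * cos x ^ n) * (sin x * sin x)) by ring.
    rewrite E. real_eq. field. lra.
  - intros x. apply continuous_minus_R; apply continuous_mult_R;
      solve [apply continuous_const | apply C].
Qed.

(** Factoring out [dfact_ratio] turns the reduction formula into a summation:
    [s] is the sum reached so far. *)
Lemma weighted_cos_integral_step (b s : R) (n : nat) :
  cos b ^ S n * sin b = 0 ->
  weighted_cos_integral b n = 2 * (1 - cos b ^ S (S n)) * dfact_ratio n * s ->
  weighted_cos_integral b (S (S n))
  = 2 * (1 - cos b ^ S (S n)) * dfact_ratio (S (S n))
    * (s + arcsin_coef (S n)).
Proof.
  intros Hb Hn.
  pose proof (lt_0_INR (S (S n)) ltac:(lia)).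
  apply (Rmult_eq_reg_l (INR (S (S n)))); [|lra].
  rewrite weighted_cos_integral_SS, Hn by exact Hb.
  unfold arcsin_coef. set (c := 1 - cos b ^ S (S n)).
  transitivity (2 * c * (INR (S (S n)) * dfact_ratio (S (S n)) * s
    + INR (S (S n)) * (dfact_ratio (S n) * dfact_ratio (S (S n))) / INR (S (S n)))).
  - rewrite dfact_ratio_mul_S, dfact_ratio_SS. field. lra.
  - field. lra.
Qed.

Lemma weighted_cos_integral_odd (m : nat) :
  weighted_cos_integral PI (2 * m + 1)
  = 4 * dfact_ratio (2 * m + 1) * odd_sum (2 * m + 1).
Proof.
  rewrite odd_sum_arcsin_coef.
  assert (Hc : forall j, 2 * (1 - cos PI ^ (2 * j + 1)) = 4).
  { intros j. rewrite cos_PI, Nat.add_1_r, pow_1_odd. ring. }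
  induction m as [|m IH].
  - unfold weighted_cos_integral.
    rewrite (RInt_derivative (fun x => (PI - 2 * x) * sin x - 2 * cos x)).
    + rewrite sin_0, cos_0, sin_PI, cos_PI.
      unfold arcsin_coef, dfact_ratio. simpl. field.
    + intros x. auto_derive; [exact I|real_eq; simpl; ring].
    + intros x. apply (ex_derive_continuous (V := R_NormedModule)). auto_derive. exact I.
  - rewrite tech5.
    replace (2 * S m + 1)%nat with (S (S (2 * m + 1))) by lia.
    rewrite (weighted_cos_integral_step PI (sum_f_R0 (fun j => arcsin_coef (2 * j)) m)).
    + replace (S (S (2 * m + 1))) with (2 * S m + 1)%nat by lia. rewrite Hc.
      now replace (S (2 * m + 1)) with (2 * S m)%nat by lia.
    + rewrite sin_PI. ring.
    + replace (S (S (2 * m + 1))) with (2 * S m + 1)%nat by lia. now rewrite Hc.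
Qed.

Lemma weighted_cos_integral_even (m : nat) :
  weighted_cos_integral (PI / 2) (2 * m + 2)
  = 2 * dfact_ratio (2 * m + 2) * even_sum (2 * m + 2).
Proof.
  rewrite even_sum_arcsin_coef.
  induction m as [|m IH].
  - change (2 * 0 + 2)%nat with 2%nat.
    (* The integral for n = 0 vanishes, which starts the summation at 0. *)
    rewrite (weighted_cos_integral_step (PI / 2) 0).
    + rewrite cos_PI2. unfold arcsin_coef, dfact_ratio. simpl. field.
    + rewrite cos_PI2. simpl. ring.
    + rewrite Rmult_0_r. unfold weighted_cos_integral.
      rewrite (RInt_derivative (fun x => PI / 2 * x - x ^ 2)).
      * field.
      * intros x. auto_derive; [exact I|real_eq; simpl; ring].
      * intros x. apply (ex_derive_continuous (V := R_NormedModule)). auto_derive. exact I.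
  - rewrite tech5.
    replace (2 * S m + 2)%nat with (S (S (2 * m + 2))) by lia.
    rewrite (weighted_cos_integral_step (PI / 2) (sum_f_R0 (fun j => arcsin_coef (2 * j + 1)) m)).
    + rewrite cos_PI2, pow_i by lia.
      rewrite Rminus_0_r, Rmult_1_r.
      now replace (S (2 * m + 2)) with (2 * S m + 1)%nat by lia.
    + rewrite cos_PI2, pow_i by lia. ring.
    + rewrite cos_PI2, (pow_i (S (S _))) by lia. rewrite IH. ring.
Qed.

(** * The area formulas and the theorem *)

Lemma limiting_area_odd (m : nat) :
  is_limiting_area (2 * m + 1)
    (8 / PI * (INR (fact (2 * m + 1)) / INR (dfact (2 * m + 1)) ^ 2)
     * odd_sum (2 * m + 1)).
Proof.
  pose proof PI_RGT_0.
  replace (8 / PI * (INR (fact (2 * m + 1)) / INR (dfact (2 * m + 1)) ^ 2)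
           * odd_sum (2 * m + 1))
    with (/ PI * total_distance PI (fun x => cos x ^ (2 * m + 1))).
  - apply limiting_area_total_distance.
  - rewrite total_distance_decreasing.
    + fold (weighted_cos_integral PI (2 * m + 1)).
      rewrite weighted_cos_integral_odd, fact_div_dfact_sqr. field. lra.
    + lra.
    + apply continuous_cos_pow.
    + intros x y. apply cos_pow_decreasing_odd. now exists m.
Qed.

Lemma limiting_area_even (m : nat) :
  is_limiting_area (2 * m + 2)
    (16 / PI * (INR (fact (2 * m + 2)) / INR (dfact (2 * m + 2)) ^ 2)
     * even_sum (2 * m + 2)).
Proof.
  pose proof PI_RGT_0.
  replace (16 / PI * (INR (fact (2 * m + 2)) / INR (dfact (2 * m + 2)) ^ 2)
           * even_sum (2 * m + 2))
    with (/ PI * total_distance (2 * (PI / 2)) (fun x => cos x ^ (2 * m + 2))).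
  - replace (2 * (PI / 2)) with PI by field. apply limiting_area_total_distance.
  - rewrite (total_distance_fold (INR (2 * m + 2))), total_distance_decreasing.
    + fold (weighted_cos_integral (PI / 2) (2 * m + 2)).
      rewrite weighted_cos_integral_even, fact_div_dfact_sqr. field. lra.
    + lra.
    + apply continuous_cos_pow.
    + intros x y. apply cos_pow_decreasing_quarter.
    + apply lipschitz_cos_pow.
    + lra.
    + intros x. replace (2 * (PI / 2) - x) with (- (x - PI)) by field.
      rewrite cos_neg, cos_minus, cos_PI, sin_PI.
      replace (cos x * -1 + sin x * 0) with (- cos x) by ring.
      replace (2 * m + 2)%nat with (2 * (m + 1))%nat by lia.
      rewrite !pow_mult. f_equal. ring.
Qed.

Theorem theorem4 (n : nat) (hn : (0 < n)%nat) :
  ((Nat.Odd n ->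
      is_limiting_area n
        (8 / PI * (INR (fact n) / INR (dfact n) ^ 2) * odd_sum n)) /\
   (Nat.Even n ->
      is_limiting_area n
        (16 / PI * (INR (fact n) / INR (dfact n) ^ 2) * even_sum n)))
  /\
  (Nat.Odd n ->
     (exists a : nat -> R, is_egf a (fun x => asin x / (1 - x))) /\
     (forall a : nat -> R, is_egf a (fun x => asin x / (1 - x)) ->
        INR (fact n) * odd_sum n = a n))
  /\
  (Nat.Even n ->
     (exists b : nat -> R, is_egf b (fun x => asin x ^ 2 / (2 * (1 - x)))) /\
     (forall b : nat -> R, is_egf b (fun x => asin x ^ 2 / (2 * (1 - x))) ->
        INR (fact n) * even_sum n = b n)).
Proof.
  assert (Heven : Nat.Even n -> exists m, n = (2 * m + 2)%nat).
  { intros [m Hm]. exists (m - 1)%nat. lia. }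
  assert (Hasin : is_egf
      (fun m => INR (fact m) * sum_f_R0 (PS_Int (weighted_ratio 1 0)) m)
      (fun x => asin x / (1 - x))).
  { eapply is_egf_ext; [|apply (is_egf_arcsin_combination 1 0); lra].
    intros x. simpl. f_equal. ring. }
  assert (Hasin2 : is_egf
      (fun m => INR (fact m) * sum_f_R0 (PS_Int (weighted_ratio 0 1)) m)
      (fun x => asin x ^ 2 / (2 * (1 - x)))).
  { eapply is_egf_ext; [|apply (is_egf_arcsin_combination 0 1); lra].
    intros x. simpl. unfold Rdiv. rewrite Rinv_mult. ring. }
  split; [split|split].
  - intros [m ->]. apply limiting_area_odd.
  - intros H. destruct (Heven H) as [m ->]. apply limiting_area_even.
  - intros [m ->]. split; [eexists; exact Hasin|].
    intros a Ha. rewrite <- odd_sum_PS_Int.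
    exact (is_egf_unique _ _ _ (2 * m + 1) Hasin Ha).
  - intros H. destruct (Heven H) as [m ->]. split; [eexists; exact Hasin2|].
    intros b Hb. rewrite <- even_sum_PS_Int.
    exact (is_egf_unique _ _ _ (2 * m + 2) Hasin2 Hb).
Qed.
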